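(* Let $m\ge 2$ be an integer, let $c_+:\mathbb{R}\to\mathbb{R}$ be an arbitrary smooth function with $c_+(x)>0$ for all $x\in\mathbb{R}$, let $a_1<0$ be an arbitrary negative real number, let $a_2=1$ and $I=[a_1,a_2]$. Define $F:\mathbb{R}^2\times I\to\mathbb{R}$ by $F(x_1,x_2,t):=x_2-t\,c_+(x_1)$. Let $J=\{1,2\}$, $S_i=\{(x_1,x_2)\in\mathbb{R}^2\mid x_2=a_i c_+(x_1)\}$ for $i=1,2$, and $D=\{(x_1,x_2)\in\mathbb{R}^2\mid a_1c_+(x_1)<x_2<a_2c_+(x_1)\}$. Then $F$, together with $D$, $I$ and $\{S_j\}_{j\in J}$, is an admissible foliated representation of $D$ (as defined in the context, with $n=2$), the set $$X_{F,m}:=\Big\{(x_1,x_2,t,(y_j)_{j=1}^{m-1})\in\mathbb{R}^2\times I\times\mathbb{R}^{m-1}\;\Big|\; x_2-t\,c_+(x_1)=0,\ (t-a_1)(a_2-t)-\sum_{j=1}^{m-1}y_j^2=0\Big\}$$ is an $m$-dimensional smooth submanifold of $\mathbb{R}^{m+2}$ with no boundary, and the restriction $\pi_{m+2,1}|_{X_{F,m}}:X_{F,m}\to\mathbb{R}$ has no critical point.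
   Context: Smooth means $C^\infty$. $\pi_{k_1+k_2,k_1}:\mathbb{R}^{k_1+k_2}\to\mathbb{R}^{k_1}$ denotes the projection to the first $k_1$ coordinates; in particular $\pi_{m+2,1}$ sends $(x_1,x_2,t,(y_j))$ to $x_1$. A critical point of a real-valued smooth function on a manifold is a point where its differential vanishes. A function on $\mathbb{R}^n\times I$ is smooth if it extends smoothly to an open neighborhood in $\mathbb{R}^{n+1}$. Admissible foliated representation (case $I=[a_1,a_2]$): $D\subset\mathbb{R}^n$ is open, $\overline{D}\setminus D=\bigsqcup_{j\in J}S_j$ with $J$ finite, each $S_j$ is an $(n-1)$-dimensional smooth submanifold of $\mathbb{R}^n$ without boundary that is a union of finitely many connected components of the zero set of some smooth function on $\mathbb{R}^n$ having no critical point on $S_j$; $F:\mathbb{R}^n\times I\to\mathbb{R}$ is smooth and, with $F_t(x):=F(x,t)$: (1) $\overline{D}=\{x\in\mathbb{R}^n\mid F(x,t)=0\text{ for some }t\in I\}$; (2) $F_{t_1}^{-1}(0)\cap F_{t_2}^{-1}(0)=\emptyset$ for distinct $t_1,t_2\in I$; there are $J_1,J_2\subset J$ with $J=J_1\sqcup J_2$ and $F_{a_i}^{-1}(0)=\bigsqcup_{j\in J_i}S_j$ for $i=1,2$; and $F_{a_i}$ has no critical point on $F_{a_i}^{-1}(0)$ for $i=1,2$; (3) $\frac{\partial F}{\partial t}\neq0$ at every point of $\mathbb{R}^n\times I$. *)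

(* Defs.v *)
From HB Require Import structures.
From mathcomp Require Import all_boot all_order all_algebra.
From mathcomp Require Import all_classical all_reals all_analysis.

Set Implicit Arguments.
Unset Strict Implicit.
Unset Printing Implicit Defensive.

Import Order.TTheory GRing.Theory Num.Theory.
Import numFieldNormedType.Exports.

Local Open Scope classical_set_scope.
Local Open Scope ring_scope.

(* Only meant for finite-dimensional V, where continuity of all the iterated
   directional derivatives is the usual C^k condition, and for open U. *)
Fixpoint Ck_on (R : realType) (V W : normedModType R) (k : nat)
    (U : set V) (f : V -> W) : Prop :=
  match k with
  | 0 => forall x, U x -> {for x, continuous f}
  | k'.+1 => (forall x, U x -> differentiable f x) /\
             (forall v : V, Ck_on k' U ('D_v f))
  end.

Definition smooth_on (R : realType) (V W : normedModType R)
    (U : set V) (f : V -> W) : Prop :=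
  forall k, Ck_on k U f.

Section Submanifolds.
Variables (R : realType) (N : nat).
Local Notation E := 'rV[R]_N.

(* R^d inside R^N: all the coordinates from the d-th (counting from 0) on
   vanish. *)
Definition coordinate_slice (d : nat) : set E :=
  [set x : E | forall i : 'I_N, (d <= i)%N -> x 0 i = 0].

Definition diffeomorphism (U V : set E) (phi psi : E -> E) : Prop :=
  [/\ open U /\ open V,
      smooth_on U phi /\ smooth_on V psi,
      forall x, U x -> V (phi x) /\ psi (phi x) = x &
      forall y, V y -> U (psi y) /\ phi (psi y) = y].

(* Embedded d-dimensional submanifold of R^N without boundary; it is allowed
   to be empty, and need not be closed in R^N. *)
Definition smooth_submanifold (d : nat) (S : set E) : Prop :=
  (d <= N)%N /\
  forall p, S p -> exists (U V : set E) (phi psi : E -> E),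
    [/\ U p, diffeomorphism U V phi psi &
        phi @` (S `&` U) = coordinate_slice d `&` V].

Definition tangent_vector (S : set E) (p v : E) : Prop :=
  exists (e : R) (gamma : R -> E),
    [/\ 0 < e, smooth_on (ball (0 : R) e) gamma,
        forall s, ball (0 : R) e s -> S (gamma s),
        gamma 0 = p & derive1 gamma 0 = v].

(* p is a critical point of the restriction of f to the submanifold S: the
   differential at p of this restriction is 'd f p restricted to the tangent
   space of S at p.  Only meant for f smooth near p. *)
Definition critical_point (S : set E) (f : E -> R) (p : E) : Prop :=
  S p /\ forall v, tangent_vector S p v -> 'd f p v = 0.

(* S is the union of finitely many connected components of the zero set of a
   smooth function on R^N without critical points on S. *)
Definition regular_components (S : set E) : Prop :=
  exists g : E -> R,
    [/\ smooth_on setT g,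
        exists CC : set (set E),
          [/\ finite_set CC,
              forall C, CC C ->
                exists2 x, g x = 0 & C = connected_component (g @^-1` [set 0]) x &
              S = \bigcup_(C in CC) C] &
        forall p, S p -> ~ critical_point setT g p].

End Submanifolds.

Section AdmissibleFoliatedRepresentation.
Variables (R : realType) (n : nat).

(* R^n x R plays the role of R^(n+1). *)
Definition smooth_on_slab (a1 a2 : R) (F : 'rV[R]_n -> R -> R) : Prop :=
  exists (U : set ('rV[R]_n * R)) (G : 'rV[R]_n * R -> R),
    [/\ open U, smooth_on U G &
        forall x t, a1 <= t <= a2 -> U (x, t) /\ G (x, t) = F x t].

(* The derivative with respect to t is taken within [a1, a2], hence one-sided
   at a1 and a2: the values of F outside [a1, a2] are irrelevant. *)
Definition partial_t (a1 a2 : R) (F : 'rV[R]_n -> R -> R)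
    (x : 'rV[R]_n) (t : R) : R :=
  lim ((fun s => (F x s - F x t) / (s - t)) @ within `[a1, a2] t^').

Definition admissible_foliated_representation
    (D : set 'rV[R]_n) (a1 a2 : R) (J : finType) (S : J -> set 'rV[R]_n)
    (F : 'rV[R]_n -> R -> R) : Prop :=
  [/\ (0 < n)%N /\ a1 < a2,
      [/\ open D,
          closure D `\` D = \bigcup_(j in setT) S j,
          trivIset setT S &
          forall j, smooth_submanifold n.-1 (S j) /\ regular_components (S j)],
      smooth_on_slab a1 a2 F &
      [/\ closure D = [set x : 'rV[R]_n | exists2 t, a1 <= t <= a2 & F x t = 0],
          forall t1 t2, a1 <= t1 <= a2 -> a1 <= t2 <= a2 -> t1 <> t2 ->
            [set x : 'rV[R]_n | F x t1 = 0] `&` [set x | F x t2 = 0] = set0,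
          exists J1 J2 : {set J},
            [/\ J1 :|: J2 = [set: J]%SET, J1 :&: J2 = finset.set0,
                [set x : 'rV[R]_n | F x a1 = 0] = \bigcup_(j in [set` J1]) S j &
                [set x : 'rV[R]_n | F x a2 = 0] = \bigcup_(j in [set` J2]) S j],
          forall x,
            (F x a1 = 0 -> ~ critical_point setT (F ^~ a1) x) /\
            (F x a2 = 0 -> ~ critical_point setT (F ^~ a2) x) &
          forall x t, a1 <= t <= a2 -> partial_t a1 a2 F x t != 0]].

End AdmissibleFoliatedRepresentation.

(* The row vector z stands for the point (x_1, x_2, t, y_1, ..., y_(m-1)), whose
   coordinates are numbered from 0: t has index 2 and y_(j+1) index j + 3. *)
Definition X_F (R : realType) (m : nat) (a1 a2 : R)
    (F : 'rV[R]_2 -> R -> R) : set 'rV[R]_(m.+2) :=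
  [set z : 'rV[R]_m.+2 | let x := \row_(i < 2) z 0 (inord i) in
           let t := z 0 (inord 2) in
           let y := fun j : 'I_m.-1 => z 0 (inord (j + 3)) in
           [/\ a1 <= t <= a2, F x t = 0 &
               (t - a1) * (a2 - t) - \sum_(j < m.-1) y j ^+ 2 = 0]].

Arguments X_F {R} m a1 a2 F.

(* Main.v *)
Require Import Defs.
From HB Require Import structures.
From mathcomp Require Import zify ring lra.
From mathcomp Require Import all_boot all_order all_fingroup all_algebra.
From mathcomp Require Import all_classical all_reals all_analysis.
Set Implicit Arguments.
Unset Strict Implicit.
Unset Printing Implicit Defensive.
Import Order.TTheory GRing.Theory Num.Theory.
Import numFieldNormedType.Exports.
Local Open Scope classical_set_scope.
Local Open Scope ring_scope.

(** The three claims have elementary reasons.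

    The leaves of the foliation are the graphs of the functions t c.  Since
    c > 0, these graphs are pairwise disjoint and sweep out the closed band
    between the graphs of a1 c and a2 c, which gives the closure and the
    boundary of D.  Every leaf function x |-> x_2 - t c(x_1) has derivative 1
    along x_2, hence no critical point at all, and the derivative of F in t is
    - c(x_1) < 0.  A leaf is the image of a line, hence connected, so it is the
    single component of the zero set of its leaf function ([admissible_band]).

    The shear that subtracts t c(x_1) from x_2 maps X onto the product of the
    x_1-line with the sphere (t - a1) (a2 - t) = |y|^2, whose poles are the
    points y = 0, t = a1 and y = 0, t = a2.  With a pole as origin of the space
    of the (t, y), the inversion v |-> v / |v|^2 is an involutive diffeomorphism
    away from the origin and carries the sphere, the pole excepted, onto an
    affine hyperplane: it extends a stereographic projection to the ambient
    space.  So shear,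
    translations, inversion and a permutation of the coordinates flatten X
    near each of its points ([smooth_submanifold_X_F]).  Charts are composed
    with [flat_at_diffeomorphism]; inversions have the advantage over graph
    charts that they only need the smoothness of rational functions.

    Moving x_1 with t and y fixed, and x_2 = t c(x_1), stays in X and changes
    the projection to x_1 at unit speed, so this projection has no critical
    point ([noncritical_X_F]).

    All this rests on a calculus of smooth maps: sums, products, inverses and
    the chain rule, each by induction on the order of differentiability. *)

(** * Calculus of functions of class C^k *)

Section SmoothCalculus.
Variable R : realType.
Implicit Type V : normedModType R.

(** Formulas for derivatives hold only on the open set under consideration,
    so differentiability and [Ck_on] must be shown to be local. *)
Lemma near_eq_differentiable V (W : normedModType R) (f g : V -> W) x :
  (\near x, f x = g x) -> differentiable f x -> differentiable g x.
Proof.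
move=> fg df.
have dg : g \o shift x = cst (g x) + 'd f x +o_ 0 id.
  have /eqaddoP fo := diff_locally df.
  have fg0 : \forall h \near (0 : V), f (h + x) = g (h + x).
    have := fg; rewrite (near_shift 0 x) subr0; apply: filterS => h /=.
    by rewrite ?[x + _]addrC.
  apply/eqaddoP => e e0; have := fo e e0; have := fg0; apply: filterS2 => h.
  by move=> fgh; rewrite !fctE /= -fgh -(nbhs_singleton fg).
apply/diff_locallyP; rewrite (diff_unique (diff_continuous df) dg).
by split => //; exact: diff_continuous.
Qed.

Lemma near_open V (U : set V) (P : V -> Prop) x :
  open U -> U x -> (forall y, U y -> P y) -> \near x, P x.
Proof. by move=> oU Ux UP; apply: filterS UP _; exact: open_nbhs_nbhs. Qed.

Lemma eq_Ck_on V (W : normedModType R) U k (f g : V -> W) :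
  open U -> (forall x, U x -> f x = g x) -> Ck_on k U f -> Ck_on k U g.
Proof.
move=> oU; elim: k f g => [|k IH] f g fg /=.
  move=> cf x Ux; rewrite /prop_for /continuous_at -(fg _ Ux).
  apply: cvg_trans (cf x Ux); apply: near_eq_cvg.
  by apply: near_open oU Ux _ => y Uy; rewrite (fg _ Uy).
move=> [df Ckf]; split=> [x Ux|v].
  by apply: near_eq_differentiable (df x Ux); exact: near_open oU Ux fg.
apply: IH (Ckf v) => x Ux; apply: near_eq_derive.
exact: near_open oU Ux fg.
Qed.

(** The closure properties of C^k functions are proved in this form: it suffices
    to exhibit a C^k formula for each directional derivative. *)
Lemma Ck_onS V (W : normedModType R) U k (f : V -> W) (df : V -> V -> W) :
  open U -> (forall x, U x -> differentiable f x) ->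
  (forall v x, U x -> 'd f x v = df v x) ->
  (forall v, Ck_on k U (df v)) -> Ck_on k.+1 U f.
Proof.
move=> oU dfU dfE Ckdf; split=> // v.
by apply: eq_Ck_on (Ckdf v) => // x Ux; rewrite deriveE ?dfE //; exact: dfU.
Qed.

Lemma Ck_on_continuous V (W : normedModType R) U k (f : V -> W) x :
  Ck_on k U f -> U x -> {for x, continuous f}.
Proof.
case: k => [|k]; first exact.
by move=> [df _] Ux; exact: differentiable_continuous (df x Ux).
Qed.

Lemma Ck_onW V (W : normedModType R) U k (f : V -> W) :
  Ck_on k.+1 U f -> Ck_on k U f.
Proof.
elim: k f => [|k IH] f Ckf; first by move=> x; exact: Ck_on_continuous Ckf.
by case: Ckf => df Ckf; split=> // v; exact: IH.
Qed.

Lemma sub_Ck_on V (W : normedModType R) (U U' : set V) k (f : V -> W) :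
  U `<=` U' -> Ck_on k U' f -> Ck_on k U f.
Proof.
move=> UU'; elim: k f => [|k IH] f /=; first by move=> cf x /UU'/cf.
by move=> [df Ckf]; split=> [x /UU'/df//|v]; exact: IH.
Qed.

Lemma Ck_on_cst V (W : normedModType R) U k (w : W) :
  Ck_on k U (fun _ : V => w).
Proof.
elim: k w => [|k IH] w /=; first by move=> x _; exact: cvg_cst.
split=> [x _|v]; first exact: differentiable_cst.
suff -> : 'D_v (fun _ : V => w) = fun=> 0 by exact: IH.
by apply/funext => x; exact: derive_cst.
Qed.

Lemma Ck_on_id V U k : open U -> Ck_on k U (@id V).
Proof.
case: k => [|k] oU; first by move=> x _; exact: cvg_id.
apply: (@Ck_onS _ _ _ _ _ (fun v _ => v)) => // [v x _|v].
- by rewrite diff_val.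
- exact: Ck_on_cst.
Qed.

Lemma Ck_on_linear_comp V (W W' : normedModType R) U k (l : W -> W')
    (f : V -> W) :
  linear l -> continuous l -> open U -> Ck_on k U f -> Ck_on k U (l \o f).
Proof.
move=> ll cl oU.
pose lM := GRing.isLinear.Build _ _ _ _ _ ll.
pose L : {linear W -> W'} := HB.pack l lM.
have dl y : differentiable l y by exact: (@linear_differentiable _ _ _ L).
elim: k f => [|k IH] f; first by
  move=> cf x Ux; apply: continuous_comp; [exact: cf|exact: cl].
move=> [df Df].
apply: (@Ck_onS _ _ _ _ _ (fun v x => l ('D_v f x))) => // [x Ux|v x Ux|v].
- by apply: differentiable_comp => //; exact: df.
- rewrite diff_comp //=; last exact: df.
  by rewrite (@diff_lin _ _ _ L) // deriveE //; exact: df.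
- exact: IH (Df v).
Qed.

Lemma Ck_onD V (W : normedModType R) U k (f g : V -> W) :
  open U -> Ck_on k U f -> Ck_on k U g -> Ck_on k U (fun x => f x + g x).
Proof.
move=> oU; elim: k f g => [|k IH] f g /=.
  by move=> cf cg x Ux; apply: cvgD; [exact: cf|exact: cg].
move=> [df Ckf] [dg Ckg].
apply: (@Ck_onS _ _ _ _ _ (fun v x => 'D_v f x + 'D_v g x)) => //.
- by move=> x Ux; apply: differentiableD; [exact: df|exact: dg].
- move=> v x Ux; rewrite diffD ?deriveE //; do ?[exact: df|exact: dg].
- by move=> v; exact: IH.
Qed.

Lemma Ck_on_sum V (W : normedModType R) U k (I : Type) (r : seq I) (P : pred I)
    (f : I -> V -> W) :
  open U -> (forall i, P i -> Ck_on k U (f i)) ->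
  Ck_on k U (fun x => \sum_(i <- r | P i) f i x).
Proof.
move=> oU Ckf; elim: r => [|i r IH].
  by apply: eq_Ck_on (Ck_on_cst _ _ 0) => // x _; rewrite big_nil.
case: (boolP (P i)) => Pi; last first.
  by apply: eq_Ck_on IH => // x _; rewrite big_cons (negPf Pi).
apply: eq_Ck_on (Ck_onD oU (Ckf i Pi) IH) => // x _.
by rewrite big_cons Pi.
Qed.

Lemma Ck_onM V U k (f g : V -> R) :
  open U -> Ck_on k U f -> Ck_on k U g -> Ck_on k U (fun x => f x * g x).
Proof.
move=> oU; elim: k f g => [|k IH] f g Ckf Ckg.
  by move=> x Ux; apply: cvgM; [exact: Ckf|exact: Ckg].
have [df Df] := Ckf; have [dg Dg] := Ckg.
apply: (@Ck_onS _ _ _ _ _ (fun v x => f x * 'D_v g x + g x * 'D_v f x)) => //.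
- by move=> x Ux; apply: differentiableM; [exact: df|exact: dg].
- by move=> v x Ux; rewrite diffM ?deriveE //; do ?[exact: df|exact: dg].
- move=> v; apply: Ck_onD => //; apply: IH; do ?exact: Ck_onW.
    exact: Dg.
  exact: Df.
Qed.

Lemma Ck_onZl V (W : normedModType R) U k (f : V -> R) (w : W) :
  open U -> Ck_on k U f -> Ck_on k U (fun x => f x *: w).
Proof.
move=> oU Ckf.
apply: (@Ck_on_linear_comp V R W U k ( *:%R ^~ w) f) => //.
  by move=> a u v; rewrite scalerDl scalerA.
exact: scalel_continuous.
Qed.

Lemma Ck_onV V U k (f : V -> R) :
  open U -> (forall x, U x -> f x != 0) -> Ck_on k U f ->
  Ck_on k U (fun x => (f x)^-1).
Proof.
move=> oU f0; elim: k => [|k IH] Ckf.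
  by move=> x Ux; apply: cvgV; [exact: f0|exact: Ckf].
have [df Df] := Ckf; have := IH (Ck_onW Ckf) => Ckif.
apply: (@Ck_onS _ _ _ _ _
  (fun v x => - 1 * ((f x)^-1 * (f x)^-1 * 'D_v f x))) => //.
- by move=> x Ux; apply: differentiableV; [exact: df|exact: f0].
- move=> v x Ux; rewrite diffV ?deriveE //; do ?[exact: df|exact: f0].
  by rewrite mulN1r /= -mulNr expr2 invfM.
- move=> v; apply: Ck_onM => //; first exact: Ck_on_cst.
  by apply: Ck_onM => //; [exact: Ck_onM|exact: Df].
Qed.

(** The chain rule, in the form
    D_v (g o u) = sum_i (D_v f_i) * ((D_(e_i) g) o u) with u = sum_i f_i e_i.
    Writing the inner map in a frame e makes every term on the right a product
    of real functions to which the induction hypothesis applies; the scalar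
    case is W = R with e = (1), and maps to row vectors use the standard
    basis. *)
Lemma Ck_on_comp_frame V (W : normedModType R) U (U' : set W) k n
    (e : 'I_n -> W) (f : 'I_n -> V -> R) (g : W -> R) :
  open U -> (forall x, U x -> U' (\sum_i f i x *: e i)) ->
  (forall i, Ck_on k U (f i)) -> Ck_on k U' g ->
  Ck_on k U (fun x => g (\sum_i f i x *: e i)).
Proof.
move=> oU fU; elim: k f g fU => [|k IH] f g fU Ckf Ckg.
  have cF : Ck_on 0 U (fun x => \sum_i f i x *: e i).
    by apply: Ck_on_sum => // i _; exact: Ck_onZl.
  by move=> x Ux; apply: (@continuous_comp _ _ _ _ g); [exact: cF|apply/Ckg/fU].
have CkF : Ck_on k.+1 U (fun x => \sum_i f i x *: e i).
  by apply: Ck_on_sum => // i _; exact: Ck_onZl.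
have [dF _] := CkF; have [dg Dg] := Ckg.
apply: (@Ck_onS _ _ _ _ _
  (fun v x => \sum_i 'D_v (f i) x * 'D_(e i) g (\sum_i f i x *: e i))) => //.
- move=> x Ux; apply: (@differentiable_comp _ _ _ _ _ g); first exact: dF.
  exact/dg/fU.
- move=> v x Ux.
  have dgx : differentiable g (\sum_i f i x *: e i) by exact/dg/fU.
  rewrite (diff_comp (dF x Ux) dgx) /= -(deriveE _ (dF x Ux)).
  rewrite (_ : (fun x0 => _) = \sum_i (fun x => f i x *: e i)); last first.
    by apply/funext => y; rewrite fct_sumE.
  have dfi i : differentiable (f i) x by case: (Ckf i) => + _; exact.
  rewrite derive_sum => [|i]; last first.
    exact/diff_derivable/differentiableZl.
  rewrite linear_sum; apply: eq_bigr => i _.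
  rewrite deriveE ?diffZl // ?linearZ; last exact: differentiableZl.
  by rewrite -!deriveE.
- move=> v; apply: Ck_on_sum => // i _; apply: Ck_onM => //.
    by case: (Ckf i) => _; exact.
  apply: (IH f ('D_(e i) g)); first exact: fU.
    by move=> j; exact: Ck_onW.
  exact: Dg.
Qed.

End SmoothCalculus.

(** * Smooth maps *)

Section SmoothMaps.
Variable R : realType.
Implicit Type V : normedModType R.

Lemma smooth_on_cst V (W : normedModType R) U (w : W) :
  smooth_on U (fun _ : V => w).
Proof. by move=> k; exact: Ck_on_cst. Qed.

Lemma smooth_on_linear V (W : normedModType R) U (l : V -> W) :
  linear l -> continuous l -> open U -> smooth_on U l.
Proof.
by move=> ll cl oU k; apply: Ck_on_linear_comp => //; exact: Ck_on_id.
Qed.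

Lemma smooth_onD V (W : normedModType R) U (f g : V -> W) :
  open U -> smooth_on U f -> smooth_on U g -> smooth_on U (fun x => f x + g x).
Proof. by move=> oU sf sg k; exact: Ck_onD. Qed.

Lemma smooth_onM V U (f g : V -> R) :
  open U -> smooth_on U f -> smooth_on U g -> smooth_on U (fun x => f x * g x).
Proof. by move=> oU sf sg k; exact: Ck_onM. Qed.

Lemma smooth_onB V U (f g : V -> R) :
  open U -> smooth_on U f -> smooth_on U g -> smooth_on U (fun x => f x - g x).
Proof.
move=> oU sf sg; have -> : (fun x => f x - g x) = (fun x => f x + -1 * g x).
  by apply/funext => x; rewrite mulN1r.
by apply: smooth_onD => //; apply: smooth_onM => //; exact: smooth_on_cst.
Qed.

Lemma smooth_onV V U (f : V -> R) :
  open U -> (forall x, U x -> f x != 0) -> smooth_on U f ->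
  smooth_on U (fun x => (f x)^-1).
Proof. by move=> oU f0 sf k; exact: Ck_onV. Qed.

Lemma smooth_on_sum V (W : normedModType R) U (I : Type) (r : seq I)
    (P : pred I) (f : I -> V -> W) :
  open U -> (forall i, P i -> smooth_on U (f i)) ->
  smooth_on U (fun x => \sum_(i <- r | P i) f i x).
Proof. by move=> oU sf k; apply: Ck_on_sum => // i Pi; exact: sf. Qed.

Lemma smooth_on_comp_real V U (f : V -> R) (g : R -> R) :
  open U -> smooth_on U f -> smooth_on setT g -> smooth_on U (fun x => g (f x)).
Proof.
move=> oU sf sg k.
have := @Ck_on_comp_frame R V R U setT k 1 (fun=> 1) (fun=> f) g oU
  (fun _ _ => I) (fun _ => sf k) (sg k).
by apply: eq_Ck_on => // x _; rewrite big_ord1 [_ *: _]mulr1.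
Qed.

Section Coordinates.
Variable n : nat.
Local Notation E := 'rV[R]_n.

Lemma smooth_on_coord_comp V U (f : V -> E) i :
  open U -> smooth_on U f -> smooth_on U (fun x => f x 0 i).
Proof.
move=> oU sf k; apply: (@Ck_on_linear_comp _ _ _ _ _ _ (fun y : E => y 0 i)) => //.
  by move=> a u v; rewrite !mxE.
exact: coord_continuous.
Qed.

Lemma smooth_on_coord (U : set E) i : open U -> smooth_on U (fun x : E => x 0 i).
Proof.
move=> oU; apply: (@smooth_on_coord_comp _ _ id) => // k; exact: Ck_on_id.
Qed.

Lemma smooth_on_row V U (f : V -> E) :
  open U -> (forall i, smooth_on U (fun x => f x 0 i)) -> smooth_on U f.
Proof.
move=> oU sf k; have -> : f = (fun x => \sum_i f x 0 i *: delta_mx 0 i).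
  by apply/funext => x; exact: row_sum_delta.
by apply: Ck_on_sum => // i _; apply: Ck_onZl => //; exact: sf.
Qed.

Lemma smooth_on_comp_row V U (U' : set E) (f : V -> E) (g : E -> R) :
  open U -> (forall x, U x -> U' (f x)) -> smooth_on U f -> smooth_on U' g ->
  smooth_on U (fun x => g (f x)).
Proof.
move=> oU fU sf sg k.
have fE x : f x = \sum_i f x 0 i *: delta_mx 0 i by exact: row_sum_delta.
rewrite (_ : (fun x => _) = (fun x => g (\sum_i f x 0 i *: delta_mx 0 i))).
  by apply: (Ck_on_comp_frame (U' := U')) => // [x Ux|i];
    [rewrite -fE; exact: fU|exact: smooth_on_coord_comp].
by apply/funext => x; rewrite -fE.
Qed.

End Coordinates.

Lemma smooth_on_comp V n p U (U' : set 'rV[R]_n) (f : V -> 'rV[R]_n)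
    (g : 'rV[R]_n -> 'rV[R]_p) :
  open U -> open U' -> (forall x, U x -> U' (f x)) ->
  smooth_on U f -> smooth_on U' g -> smooth_on U (g \o f).
Proof.
move=> oU oU' fU sf sg; apply: smooth_on_row => // i.
apply: (@smooth_on_comp_row _ _ _ U' f (fun y => g y 0 i)) => //.
exact: smooth_on_coord_comp.
Qed.

Lemma sub_smooth_on V (W : normedModType R) (U U' : set V) (f : V -> W) :
  U `<=` U' -> smooth_on U' f -> smooth_on U f.
Proof. by move=> UU' sf k; exact: sub_Ck_on (sf k). Qed.

Lemma smooth_on_continuous V (W : normedModType R) (f : V -> W) :
  smooth_on setT f -> continuous f.
Proof. by move=> sf x; exact: (Ck_on_continuous (sf 0)). Qed.

Lemma smooth_on_open_preimage V (W : normedModType R) U (U' : set W)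
    (f : V -> W) :
  open U -> open U' -> smooth_on U f -> open (U `&` f @^-1` U').
Proof.
move=> oU oU' sf; rewrite openE => x [Ux U'fx].
apply: filterI; first exact: open_nbhs_nbhs.
by apply: (sf 0 x Ux); exact: open_nbhs_nbhs.
Qed.

End SmoothMaps.

(** * Flattening a set by composing diffeomorphisms *)

Section Straightening.
Variables (R : realType) (N : nat).
Local Notation E := 'rV[R]_N.

(** The existence of a submanifold chart at p, with the image of the chart
    described pointwise instead of by an equality of sets: this is the form
    that composes. *)
Definition flat_at d (S : set E) (p : E) : Prop :=
  exists (U V : set E) (phi psi : E -> E),
    [/\ U p, diffeomorphism U V phi psi &
        forall x, U x -> (S x <-> coordinate_slice d (phi x))].

Lemma smooth_submanifold_flat d (S : set E) :
  (d <= N)%N -> (forall p, S p -> flat_at d S p) -> smooth_submanifold d S.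
Proof.
move=> dN flatS; split=> // p /flatS[U [V [phi [psi [Up dif flat]]]]].
exists U, V, phi, psi; split=> //; have [_ _ UV VU] := dif.
apply/seteqP; split=> [_ [x [Sx Ux] <-]|y [Ty Vy]].
  by split; [exact: (flat x Ux).1|exact: (UV x Ux).1].
have [Uy yE] := VU y Vy; exists (psi y) => //; split=> //.
by apply: (flat _ Uy).2; rewrite yE.
Qed.

(** Charts pull back along local diffeomorphisms, which allows a set to be
    flattened in several simple steps. *)
Lemma flat_at_diffeomorphism d (S S' : set E) U V (h h' : E -> E) p :
  diffeomorphism U V h h' -> U p -> (forall x, U x -> (S x <-> S' (h x))) ->
  flat_at d S' (h p) -> flat_at d S p.
Proof.
move=> [[oU oV] [sh sh'] UV VU] Up SS' [U' [V' [phi [psi [U'hp dif flat]]]]].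
have [[oU' oV'] [sphi spsi] UV' VU'] := dif.
exists (U `&` h @^-1` U'), (V' `&` psi @^-1` V), (phi \o h), (h' \o psi).
split; first by split.
- split.
  + by split; exact: smooth_on_open_preimage.
  + split.
      apply: (smooth_on_comp _ oU') => //; first exact: smooth_on_open_preimage.
        by move=> x [].
      by apply: sub_smooth_on sh => x [].
    apply: (smooth_on_comp _ oV) => //; first exact: smooth_on_open_preimage.
      by move=> x [].
    by apply: sub_smooth_on spsi => x [].
  + move=> x [Ux U'hx]; have [Vhx h'h] := UV x Ux.
    by have [V'x psiphi] := UV' _ U'hx; rewrite /= /preimage /= psiphi h'h.
  + move=> y [V'y Vy]; have [U'y phipsi] := VU' y V'y.
    by have [Ux hh'] := VU _ Vy; rewrite /= /preimage /= hh' phipsi.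
- by move=> x [Ux U'hx]; apply: iff_trans (SS' x Ux) (flat _ U'hx).
Qed.

(** As g is constant along the direction in which the shear moves points, it
    takes the same value before and after, and the shear can be undone. With g
    constant this is a translation. *)
Lemma shear_diffeomorphism (k : 'I_N) (g : E -> R) :
  smooth_on setT g -> (forall x s, g (x + s *: delta_mx 0 k) = g x) ->
  diffeomorphism setT setT (fun x => x - g x *: delta_mx 0 k)
    (fun x => x + g x *: delta_mx 0 k).
Proof.
move=> sg gk.
have sgk : smooth_on setT (fun x => g x *: delta_mx 0 k : E).
  by move=> i; apply: Ck_onZl => //; exact: openT.
have sid : smooth_on setT (@id E) by move=> i; apply: Ck_on_id; exact: openT.
split; first by split; exact: openT.
- split; last by apply: smooth_onD => //; exact: openT.
  have -> : (fun x => x - g x *: delta_mx 0 k) =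
            (fun x : E => x + (0 - g x) *: delta_mx 0 k).
    by apply/funext => x; rewrite sub0r scaleNr.
  have oT : open [set: E] by exact: openT.
  apply: smooth_onD => // i; apply: Ck_onZl => //.
  by apply: smooth_onB => //; exact: smooth_on_cst.
- by move=> x _; split=> //; rewrite -scaleNr gk scaleNr subrK.
- by move=> x _; split=> //; rewrite gk addrK.
Qed.

Definition block_sqnorm (A : pred 'I_N) (x : E) : R :=
  \sum_(i | A i) x 0 i ^+ 2.

(** Inversion in the unit sphere of the coordinates selected by A, the others
    being left alone. *)
Definition inversion (A : pred 'I_N) (x : E) : E :=
  \row_i (if A i then x 0 i / block_sqnorm A x else x 0 i).

Lemma smooth_block_sqnorm A : smooth_on setT (block_sqnorm A).
Proof.
apply: smooth_on_sum => [|i _]; first exact: openT.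
by apply: smooth_onM; [exact: openT|exact/smooth_on_coord/openT..].
Qed.

Lemma block_sqnorm_inversion A x : block_sqnorm A x != 0 ->
  block_sqnorm A (inversion A x) = (block_sqnorm A x)^-1.
Proof.
move=> q0; rewrite {1}/block_sqnorm.
under eq_bigr => i Ai do rewrite mxE Ai exprMn.
by rewrite -mulr_suml expr2 mulrA mulfV // mul1r.
Qed.

Lemma inversionK A x : block_sqnorm A x != 0 ->
  inversion A (inversion A x) = x.
Proof.
move=> q0; apply/rowP => i; rewrite mxE block_sqnorm_inversion // invrK mxE.
by case: (A i) => //; rewrite divfK.
Qed.

Lemma inversion_diffeomorphism A :
  diffeomorphism [set x | block_sqnorm A x != 0] [set x | block_sqnorm A x != 0]
    (inversion A) (inversion A).
Proof.
have oU : open [set x | block_sqnorm A x != 0].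
  apply: (@open_comp _ _ (block_sqnorm A) [set y | y != 0]); last exact: open_neq.
  by move=> x _; exact/smooth_on_continuous/smooth_block_sqnorm.
have sU : smooth_on [set x | block_sqnorm A x != 0] (inversion A).
  apply: smooth_on_row => // i; have sxi := @smooth_on_coord _ _ _ i oU.
  have [Ai|Ai] := boolP (A i).
    have -> : (fun x => inversion A x 0 i) =
              (fun x => x 0 i * (block_sqnorm A x)^-1).
      by apply/funext => x; rewrite mxE Ai.
    apply: smooth_onM => //; apply: smooth_onV => //.
    exact: sub_smooth_on (smooth_block_sqnorm A).
  suff -> : (fun x => inversion A x 0 i) = (fun x => x 0 i) by [].
  by apply/funext => x; rewrite mxE (negPf Ai).
split=> // x /= q0; split; rewrite ?inversionK //;
  by rewrite block_sqnorm_inversion // invr_eq0.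
Qed.

Lemma col_perm_diffeomorphism (s : 'S_N) :
  diffeomorphism setT setT (col_perm s : E -> E) (col_perm s^-1%g).
Proof.
have sm (r : 'S_N) : smooth_on setT (col_perm r : E -> E).
  apply: smooth_on_row => [|i]; first exact: openT.
  have -> : (fun x : E => col_perm r x 0 i) = (fun x => x 0 (r i)).
    by apply/funext => x; rewrite mxE.
  exact/smooth_on_coord/openT.
split=> //; first by split; exact: openT.
- by move=> x _; split=> //; rewrite -col_permM mulVg col_perm1.
- by move=> x _; split=> //; rewrite -col_permM mulgV col_perm1.
Qed.

(** A permutation of the coordinates is itself a chart. *)
Lemma flat_at_coordinates d (S : set E) (s : 'S_N) p :
  (forall x, S x <-> (forall i : 'I_N, (d <= i)%N -> x 0 (s i) = 0)) ->
  flat_at d S p.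
Proof.
move=> SE; exists setT, setT, (col_perm s), (col_perm s^-1%g); split=> //.
  exact: col_perm_diffeomorphism.
move=> x _; apply: iff_trans (SE x) _.
by split=> + i di => /(_ i di); rewrite mxE.
Qed.

End Straightening.

(** * A criterion for a point not to be critical *)

(** The velocity of gamma is tangent to S, and by the chain rule the
    differential of f takes on it the value of the derivative of f o gamma,
    which is 1. *)
Lemma noncritical_along_curve (R : realType) N (S : set 'rV[R]_N)
    (f : 'rV[R]_N -> R) (gamma : R -> 'rV[R]_N) :
  smooth_on setT gamma -> (forall s, S (gamma s)) ->
  differentiable f (gamma 0) -> (forall s, f (gamma s) = f (gamma 0) + s) ->
  ~ critical_point S f (gamma 0).
Proof.
move=> sg Sg df fg [_ /(_ (derive1 gamma 0))].
have dg : differentiable gamma 0 by have [+ _] := sg 1; exact.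
have -> : 'd f (gamma 0) (derive1 gamma 0) = 1.
  rewrite derive1E' // -[LHS]/(('d f (gamma 0) \o 'd gamma 0) 1) -diff_comp //.
  rewrite -derive1E'; last exact: differentiable_comp.
  rewrite (_ : f \o gamma = cst (f (gamma 0)) + id); last first.
    by apply/funext => s /=; rewrite fg.
  by rewrite derive1E deriveD ?derive_cst ?derive_id ?add0r //; exact: derivable_id.
move=> H; have /H/eqP : tangent_vector S (gamma 0) (derive1 gamma 0).
  by exists 1, gamma; split=> //; exact: sub_smooth_on sg.
by rewrite oner_eq0.
Qed.

(** * Spheres through the origin are flattened by inversion *)

(** Inversion divides x_k by |x|^2, so that |x|^2 = r x_k, the equation of a
    sphere through the centre of inversion, becomes x_k = 1 / r. *)
Lemma flat_at_sphere_cylinder (R : realType) N d (A : pred 'I_N) (j k : 'I_N)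
    (s : 'S_N) (r : R) (p : 'rV[R]_N) :
  r != 0 -> ~~ A j -> A k ->
  (forall i : 'I_N, (d <= i)%N <-> s i = j \/ s i = k) ->
  block_sqnorm A p != 0 ->
  flat_at d [set x : 'rV[R]_N | x 0 j = 0 /\ block_sqnorm A x = r * x 0 k] p.
Proof.
move=> r0 Aj Ak sE qp.
have jk : (j == k) = false by apply: contraNF Aj => /eqP ->.
apply: (flat_at_diffeomorphism (S' := [set x | x 0 j = 0 /\ x 0 k = r^-1])
  (inversion_diffeomorphism R A)) => //.
  move=> x /= q0; rewrite !mxE Ak (negPf Aj).
  split=> -[-> e]; split=> //.
    by rewrite -(mulKf r0 (x 0 k)) -e -mulrA mulfV // mulr1.
  have /(congr1 (fun y => y * (r * block_sqnorm A x))) := e.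
  by rewrite mulrCA divfK // mulrA mulVf // mul1r => ->.
apply: (@flat_at_diffeomorphism _ _ _ _
  [set x : 'rV[R]_N | x 0 j = 0 /\ x 0 k = 0] _ _ _ _ _
  (shear_diffeomorphism (k := k) (g := fun=> r^-1) _ _)) => //.
- exact: smooth_on_cst.
- move=> x _; rewrite /= !mxE !eqxx jk /= mulr0 subr0 mulr1.
  by split=> -[-> e]; split=> //; apply/eqP; rewrite ?e ?subrr // -subr_eq0 e.
apply: (@flat_at_coordinates _ _ _ _ s) => x; split.
  by move=> [xj xk] i /sE[] ->.
move=> xs; split.
  by rewrite -(permKV s j); apply: xs; apply/sE; left; rewrite permKV.
by rewrite -(permKV s k); apply: xs; apply/sE; right; rewrite permKV.
Qed.

(** * The coordinates (x_1, x_2, t, y) *)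

Section Cylinder.
Variables (R : realType) (m : nat).
Local Notation E := 'rV[R]_m.+4.
Local Notation T := (inord 2 : 'I_m.+4).

Lemma val_inord k : (k < 4)%N -> (inord k : 'I_m.+4) = k :> nat.
Proof. by move=> k4; rewrite inordK // (leq_trans k4). Qed.

Lemma block_sqnorm_split (z : E) :
  block_sqnorm (fun i => (1 < i)%N) z =
  z 0 T ^+ 2 + \sum_(j < m.+1) z 0 (inord (j + 3)) ^+ 2.
Proof.
rewrite /block_sqnorm big_mkcond /= 3!big_ord_recl /= !add0r.
congr (z 0 _ ^+ 2 + _); first by apply: val_inj; rewrite /= val_inord.
apply: eq_bigr => i _ /=; congr (z 0 _ ^+ 2).
apply: val_inj; rewrite /= inordK /bump /=; have := ltn_ord i; lia.
Qed.

(** In R^(m+4) the coordinates to be straightened are x_2 and t, with indices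
    1 and 2, whereas a coordinate slice constrains the indices m + 2 and m + 3:
    adding 3 modulo m + 4 sends the latter to the former. *)
Definition rotation3 : 'S_m.+4 := perm (addIr (inord 3 : 'I_m.+4)).

Lemma rotation3P (i : 'I_m.+4) :
  (m.+2 <= i)%N <-> rotation3 i = 1 \/ rotation3 i = T.
Proof.
have vE : rotation3 i = ((i + 3) %% m.+4)%N :> nat.
  by rewrite permE /= val_inord.
have iE k : (k < 4)%N -> rotation3 i = inord k <-> ((i + 3) %% m.+4 = k)%N.
  move=> k4; split=> [e|e]; first by rewrite -vE e val_inord.
  by apply: val_inj; rewrite /= vE e val_inord.
have -> : (1 : 'I_m.+4) = inord 1 by apply: val_inj; rewrite /= val_inord.
rewrite !iE //; have im := ltn_ord i; split=> [mi|].
  have [->|->] : nat_of_ord i = m.+2 \/ nat_of_ord i = m.+3 by lia.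
    by left; rewrite (_ : m.+2 + 3 = 1 * m.+4 + 1)%N ?modnMDl //; lia.
  by right; rewrite (_ : m.+3 + 3 = 1 * m.+4 + 2)%N ?modnMDl //; lia.
have [lt_im|//] := ltnP i m.+2.
by case: (ltnP (i + 3) m.+4) => im3; [rewrite modn_small //; lia|
  rewrite (_ : i + 3 = m.+4)%N ?modnn; lia].
Qed.

End Cylinder.

(** * The submanifold X *)

(** On the sphere (t - a1) (a2 - t) = |y|^2 the left side is nonnegative; this
    confines t to [a1, a2]. *)
Lemma mulr_ge0_between (R : realDomainType) (a b t : R) :
  a < b -> 0 <= (t - a) * (b - t) -> a <= t <= b.
Proof.
move=> ab; have [ta|ta] := ltP t a.
  by rewrite nmulr_rge0 ?subr_lt0 // subr_le0 leNgt (lt_trans ta).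
have [//|bt] := leP t b.
by rewrite nmulr_lge0 ?subr_lt0 // subr_le0 leNgt (lt_trans ab).
Qed.

Section SphereBundleOverGraph.
Variables (R : realType) (m : nat) (c : R -> R) (a1 a2 : R).
Hypotheses (sc : smooth_on setT c) (a12 : a1 < a2).
Local Notation E := 'rV[R]_m.+4.
Local Notation T := (inord 2 : 'I_m.+4).
Local Notation Y j := (inord (j + 3) : 'I_m.+4).
Let F : 'rV[R]_2 -> R -> R := fun x t => x 0 1 - t * c (x 0 0).
Local Notation X := (X_F m.+2 a1 a2 F).

Lemma X_FP (z : E) :
  X z <-> z 0 1 = z 0 T * c (z 0 0) /\
          (z 0 T - a1) * (a2 - z 0 T) = \sum_(j < m.+1) z 0 (Y j) ^+ 2.
Proof.
have i0 : inord (0%R : 'I_2) = 0 :> 'I_m.+4 by apply: val_inj; rewrite /= val_inord.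
have i1 : inord (1%R : 'I_2) = 1 :> 'I_m.+4 by apply: val_inj; rewrite /= val_inord.
rewrite /X_F /F /= !mxE i0 i1.
split=> [[_ /subr0_eq -> /subr0_eq ->] //|[-> e]].
split; rewrite ?e ?subrr //.
have y0 : 0 <= \sum_(j < m.+1) z 0 (Y j) ^+ 2.
  by apply: sumr_ge0 => j _; exact: sqr_ge0.
by apply: mulr_ge0_between => //; rewrite e.
Qed.

Lemma Y_neq1 (j : 'I_m.+1) : (Y j == 1) = false.
Proof. by rewrite -val_eqE /= inordK addn3 // !ltnS -ltnS ltn_ord. Qed.

Lemma Y_neq0 (j : 'I_m.+1) : (Y j == 0) = false.
Proof. by rewrite -val_eqE /= inordK addn3 // !ltnS -ltnS ltn_ord. Qed.

Lemma Y_neqT (j : 'I_m.+1) : (Y j == T) = false.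
Proof.
by rewrite -val_eqE /= (@val_inord m 2) // inordK addn3 // !ltnS -ltnS ltn_ord.
Qed.

Lemma T_neq1 : (T == 1) = false.
Proof. by rewrite -val_eqE /= val_inord. Qed.

Lemma T_neq0 : (T == 0) = false.
Proof. by rewrite -val_eqE /= val_inord. Qed.

(** The image of X under the shear: the x_1-line times a sphere. *)
Definition flat_model : set E := [set z |
  z 0 1 = 0 /\ (z 0 T - a1) * (a2 - z 0 T) = \sum_(j < m.+1) z 0 (Y j) ^+ 2].

(** The first hypothesis says that b is one of a1 and a2 and b' the other one.
    In terms of t - b the equation of the sphere is that of a sphere through
    the origin. Inversion at the pole t = b flattens it everywhere else; on the
    sphere, t = b occurs only at this pole. *)
Lemma flat_at_model_pole (b b' : R) (p : E) :
  (forall t, (t - a1) * (a2 - t) = (t - b) * (b' - t)) ->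
  b' != b -> p 0 T != b -> flat_model p -> flat_at m.+2 flat_model p.
Proof.
move=> bE b'b pT pS.
have flatE x : flat_model x <->
    (x - b *: delta_mx 0 T) 0 1 = 0 /\
    block_sqnorm (fun i => (1 < i)%N) (x - b *: delta_mx 0 T) =
    (b' - b) * (x - b *: delta_mx 0 T) 0 T.
  rewrite block_sqnorm_split !mxE !eqxx /= [1 == _]eq_sym T_neq1 mulr0 subr0.
  rewrite mulr1 /flat_model /= bE.
  under [in X in _ <-> X]eq_bigr => j _ do rewrite !mxE Y_neqT andbF mulr0 subr0.
  by split=> -[-> e]; split=> //; lra.
apply: (flat_at_diffeomorphism
  (S' := [set x : E | x 0 1 = 0 /\
                  block_sqnorm (fun i => (1 < i)%N) x = (b' - b) * x 0 T])
  (shear_diffeomorphism (k := T) (g := fun=> b) _ _)) => //.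
  exact: smooth_on_cst.
apply: (flat_at_sphere_cylinder (s := rotation3 m)) => //.
- by rewrite subr_eq0.
- by rewrite val_inord.
- exact: rotation3P.
- have [_ ->] := (flatE p).1 pS.
  by rewrite mulf_neq0 ?subr_eq0 // !mxE !eqxx mulr1 subr_eq0.
Qed.

(** The coordinate t of a point differs from a1 or from a2, so the inversion at
    one of the two poles is defined there. *)
Lemma smooth_submanifold_X_F : smooth_submanifold m.+2 X.
Proof.
apply: smooth_submanifold_flat => [|p Xp]; first by rewrite leqW.
have oT : open [set: E] by exact: openT.
have XE z : X z <-> flat_model (z - (z 0 T * c (z 0 0)) *: delta_mx 0 1).
  apply: iff_trans (X_FP z) _; rewrite /flat_model /= !mxE !eqxx T_neq1 /=.
  under [in X in _ <-> X]eq_bigr => j _ do rewrite !mxE Y_neq1 andbF mulr0 subr0.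
  rewrite mulr0 subr0 mulr1.
  by split=> -[e ->]; split=> //; [rewrite e subrr|exact: subr0_eq].
apply: (flat_at_diffeomorphism (S' := flat_model)
  (shear_diffeomorphism (k := 1) (g := fun z : E => z 0 T * c (z 0 0)) _ _)) => //.
- apply: smooth_onM => //; first exact: smooth_on_coord.
  by apply: smooth_on_comp_real => //; exact: smooth_on_coord.
- by move=> x s; rewrite !mxE T_neq1 /= !mulr0 !addr0.
have /XE pX := Xp; set q := (q in flat_at _ _ q).
have [qT|qT] := eqVneq (q 0 T) a1; last first.
  apply: (flat_at_model_pole (b := a1) (b' := a2)) => //.
  by rewrite gt_eqF.
apply: (flat_at_model_pole (b := a2) (b' := a1)) => //.
- by move=> t; ring.
- by rewrite lt_eqF.
- by rewrite qT lt_eqF.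
Qed.

(** With t and y fixed, the unit speed motion of x_1 lifts to a curve in X. *)
Lemma noncritical_X_F (p : E) : ~ critical_point X (fun z => z 0 0) p.
Proof.
move=> crit; have [Xp _] := crit.
pose gamma (s : R) : E := p + (s *: delta_mx 0 0 +
  (p 0 T * (c (p 0 0 + s) - c (p 0 0))) *: delta_mx 0 1).
have oT : open [set: R] by exact: openT.
have sid : smooth_on setT (@id R) by move=> k; exact: Ck_on_id.
have sg : smooth_on setT gamma.
  apply: smooth_onD => //; first exact: smooth_on_cst.
  apply: smooth_onD => //; first by move=> k; exact: Ck_onZl.
  move=> k; apply: Ck_onZl => //.
  apply: smooth_onM => //; first exact: smooth_on_cst.
  apply: smooth_onB => //; last exact: smooth_on_cst.
  apply: smooth_on_comp_real => //.
  by apply: smooth_onD => //; exact: smooth_on_cst.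
have g00 s : gamma s 0 0 = p 0 0 + s.
  by rewrite !mxE !eqxx /= mulr1 mulr0 addr0.
have g0 : gamma 0 = p by rewrite /gamma addr0 subrr mulr0 !scale0r !addr0.
have Xg s : X (gamma s).
  have /X_FP[e1 e2] := Xp; apply/X_FP.
  have gT : gamma s 0 T = p 0 T by rewrite !mxE T_neq1 T_neq0 !mulr0 !addr0.
  have gY (j : 'I_m.+1) : gamma s 0 (Y j) = p 0 (Y j).
    by rewrite !mxE Y_neq1 Y_neq0 !mulr0 !addr0.
  under eq_bigr => j _ do rewrite gY.
  by split; rewrite gT // g00 !mxE /= mulr0 mulr1 e1; ring.
move: crit; rewrite -g0; apply: (noncritical_along_curve sg Xg).
  exact: differentiable_coord.
by move=> s; rewrite !g00 addr0.
Qed.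

End SphereBundleOverGraph.

(** * The band between two graphs *)

Section BandBetweenGraphs.
Variables (R : realType) (c : R -> R) (a1 a2 : R).
Hypotheses (sc : smooth_on setT c) (c_gt0 : forall x, 0 < c x) (a12 : a1 < a2).
Local Notation P := 'rV[R]_2.
Let F : P -> R -> R := fun x t => x 0 1 - t * c (x 0 0).
Let S : 'I_2 -> set P := fun i =>
  [set x : P | x 0 1 = (if i == 0 then a1 else a2) * c (x 0 0)].
Let D : set P :=
  [set x : P | a1 * c (x 0 0) < x 0 1 /\ x 0 1 < a2 * c (x 0 0)].

Let oT : open [set: P] := openT.

Lemma smooth_scaled_graph (a : R) :
  smooth_on setT (fun x : P => a * c (x 0 0)).
Proof.
apply: smooth_onM => //; first exact: smooth_on_cst.
by apply: smooth_on_comp_real => //; exact: smooth_on_coord.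
Qed.

Lemma smooth_leaf_function (a : R) : smooth_on setT (F ^~ a).
Proof.
by apply: smooth_onB => //; [exact: smooth_on_coord|exact: smooth_scaled_graph].
Qed.

Lemma noncritical_leaf_function (a : R) (x : P) :
  ~ critical_point setT (F ^~ a) x.
Proof.
pose gamma (s : R) : P := x + s *: delta_mx 0 1.
have sg : smooth_on setT gamma.
  have oR : open [set: R] by exact: openT.
  apply: smooth_onD => //; first exact: smooth_on_cst.
  by move=> k; apply: Ck_onZl => //; exact: Ck_on_id.
have g0 : gamma 0 = x by rewrite /gamma scale0r addr0.
have Fg s : F (gamma s) a = F (gamma 0) a + s.
  by rewrite /F g0 !mxE /= mulr0 mulr1 !addr0 addrAC.
rewrite -[x in critical_point _ _ x]g0; apply: (noncritical_along_curve sg) => //.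
by have [+ _] := smooth_leaf_function a 1; exact.
Qed.

Lemma smooth_submanifold_graph (a : R) :
  smooth_submanifold 1 [set x : P | x 0 1 = a * c (x 0 0)].
Proof.
apply: smooth_submanifold_flat => // p _.
apply: (flat_at_diffeomorphism (S' := [set x : P | x 0 1 = 0])
  (shear_diffeomorphism (k := 1) (g := fun x : P => a * c (x 0 0)) _ _)) => //.
- exact: smooth_scaled_graph.
- by move=> x s; rewrite !mxE /= mulr0 addr0.
- move=> x _; rewrite /= !mxE /= mulr1.
  by split=> [->|/subr0_eq //]; rewrite subrr.
apply: (@flat_at_coordinates _ _ _ _ 1%g) => x /=; split=> [x1 i|/(_ 1)].
  by case: i => [[|[|//]] ?] //= _; rewrite perm1 -[RHS]x1; congr (x 0 _);
    exact: val_inj.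
by rewrite perm1; exact.
Qed.

Lemma connected_graph (a : R) : connected [set x : P | x 0 1 = a * c (x 0 0)].
Proof.
pose gr (s : R) : P := s *: delta_mx 0 0 + (a * c s) *: delta_mx 0 1.
have -> : [set x : P | x 0 1 = a * c (x 0 0)] = gr @` setT.
  apply/seteqP; split=> [x /= xE|_ [s _ <-]].
    exists (x 0 0) => //; apply/rowP => i; rewrite !mxE /=.
    by case: i => [[|[|//]] ?]; rewrite /= ?mulr0 ?mulr1 ?addr0 ?add0r -?xE;
      congr (x 0 _); exact: val_inj.
  by rewrite /= !mxE /= !mulr0 !mulr1 add0r addr0.
apply: connected_continuous_connected; first by apply/connected_intervalP.
apply: continuous_subspaceT; apply: smooth_on_continuous.
have oR : open [set: R] by exact: openT.
apply: smooth_onD => // k; apply: Ck_onZl => //; first exact: Ck_on_id.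
by apply: Ck_onM => //; exact: Ck_on_cst.
Qed.

Lemma leafE (a : R) :
  [set x : P | F x a = 0] = [set x : P | x 0 1 = a * c (x 0 0)].
Proof.
by apply/seteqP; split=> x /=; [exact: subr0_eq|rewrite /F => ->; rewrite subrr].
Qed.

Lemma regular_components_graph (a : R) :
  regular_components [set x : P | x 0 1 = a * c (x 0 0)].
Proof.
exists (F ^~ a); split; first exact: smooth_leaf_function.
- exists [set [set x : P | x 0 1 = a * c (x 0 0)]]; split.
  + exact: finite_set1.
  + move=> _ ->.
    have F0 : F ((a * c 0) *: delta_mx 0 1) a = 0.
      by rewrite /F !mxE /= mulr0 mulr1 subrr.
    exists ((a * c 0) *: delta_mx 0 1) => //.
    rewrite [_ @^-1` _]leafE connected_component_id //.
      by rewrite -leafE.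
    exact: connected_graph.
  + by rewrite bigcup_set1.
- by move=> p _; exact: noncritical_leaf_function.
Qed.

Lemma continuous_leaf_function (a : R) : continuous (F ^~ a).
Proof. by apply: smooth_on_continuous; exact: smooth_leaf_function. Qed.

Lemma open_band : open D.
Proof.
have -> : D = [set x | F x a1 > 0] `&` [set x | F x a2 < 0].
  by apply/seteqP; split=> x /=; rewrite /D /F /= subr_gt0 subr_lt0.
apply: openI.
  apply: (@open_comp _ _ (F ^~ a1) [set y | 0 < y]); last exact: open_gt.
  by move=> x _; exact: continuous_leaf_function.
apply: (@open_comp _ _ (F ^~ a2) [set y | y < 0]); last exact: open_lt.
by move=> x _; exact: continuous_leaf_function.
Qed.

(** The closed band is closed by continuity. Conversely, a point of it is the
    limit, along the vertical segment to the middle of the band, of points of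
    the open band. *)
Lemma closure_band :
  closure D = [set x : P | a1 * c (x 0 0) <= x 0 1 <= a2 * c (x 0 0)].
Proof.
apply/seteqP; split.
  have cB : closed [set x : P | a1 * c (x 0 0) <= x 0 1 <= a2 * c (x 0 0)].
    rewrite (_ : [set x | _] = [set x | F x a1 >= 0] `&` [set x | F x a2 <= 0]).
      apply: closedI.
        apply: (@closed_comp _ _ (F ^~ a1) [set y | 0 <= y]); last exact: closed_ge.
        by move=> x _; exact: continuous_leaf_function.
      apply: (@closed_comp _ _ (F ^~ a2) [set y | y <= 0]); last exact: closed_le.
      by move=> x _; exact: continuous_leaf_function.
    apply/seteqP; split=> x /=; rewrite /F subr_ge0 subr_le0.
      by move=> /andP[].
    by move=> [-> ->].
  rewrite [X in _ `<=` X](closure_id _).1 //; apply: closureS => x /= [x1 x2].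
  by rewrite !ltW.
move=> x /andP[x1 x2] B Bx.
pose h := (a1 + a2) / 2 * c (x 0 0) - x 0 1.
pose seg (s : R) : P := x + (s * h) *: delta_mx 0 1.
have segB : \forall s \near 0^'+, B (seg s).
  have cs : continuous seg.
    apply: smooth_on_continuous; have oR : open [set: R] by exact: openT.
    apply: smooth_onD => //; first exact: smooth_on_cst.
    move=> k; apply: Ck_onZl => //; apply: Ck_onM => //; first exact: Ck_on_id.
    exact: Ck_on_cst.
  apply: cvg_at_right_filter (cs 0) _ _.
  by rewrite /seg mul0r scale0r addr0.
near (0 : R)^'+ => s.
have s0 : 0 < s by near: s; exact: nbhs_right_gt.
have s1 : s < 1 by near: s; exact: nbhs_right_lt.
exists (seg s); split; last by near: s.
have cx := c_gt0 (x 0 0).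
have A12 : a1 * c (x 0 0) < a2 * c (x 0 0) by rewrite ltr_pM2r.
rewrite /D /seg /= !mxE /= mulr0 mulr1 addr0 /h mulrAC mulrDl.
move: (a1 * _) (a2 * _) (x 0 1) A12 x1 x2 s0 s1 => A B' y AB yA yB s0 s1.
(* The point at parameter s lies (1 - s) (y - A) + s (B' - A) / 2 above A, and
   (1 - s) (B' - y) + s (B' - A) / 2 below B'. *)
have h0 : 0 < s * (B' - A) by rewrite mulr_gt0 ?subr_gt0.
have h1 : 0 <= (1 - s) * (y - A) by rewrite mulr_ge0 ?subr_ge0 // ltW.
have h2 : 0 <= (1 - s) * (B' - y) by rewrite mulr_ge0 ?subr_ge0 // ltW.
by split; lra.
Unshelve. all: by end_near. Qed.

Lemma closure_bandE :
  closure D = [set x : P | exists2 t, a1 <= t <= a2 & F x t = 0].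
Proof.
rewrite closure_band; apply/seteqP; split=> x /=.
  move=> /andP[x1 x2]; exists (x 0 1 / c (x 0 0)).
    by rewrite ler_pdivlMr // ler_pdivrMr // x1.
  by rewrite /F divfK ?subrr // gt_eqF.
by move=> [t /andP[t1 t2] /subr0_eq ->]; rewrite !ler_pM2r // t1.
Qed.

Lemma boundary_band : closure D `\` D = \bigcup_(j in setT) S j.
Proof.
rewrite closure_band; apply/seteqP; split=> x /=.
  move=> [/andP[x1 x2] nD].
  move: x1; rewrite le_eqVlt => /orP[/eqP x1|x1]; first by exists 0.
  move: x2; rewrite le_eqVlt => /orP[/eqP x2|x2]; first by exists 1.
  by case: nD.
move=> [j _]; rewrite /S /D /= => ->; split.
  by case: ifP => _; rewrite lexx ler_pM2r ?(ltW a12).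
by case: (j == 0) => -[h1 h2]; [move: h1|move: h2]; rewrite ltxx.
Qed.

Lemma smooth_on_slab_band (b1 b2 : R) : smooth_on_slab b1 b2 F.
Proof.
exists setT, (fun z : P * R => F z.1 z.2).
have o : open [set: P * R] by exact: openT.
have s1 : smooth_on setT (fst : P * R -> P).
  by apply: smooth_on_linear => // z; exact: cvg_fst.
have s2 : smooth_on setT (snd : P * R -> R).
  by apply: smooth_on_linear => // z; exact: cvg_snd.
split=> //.
have si i : smooth_on setT (fun z : P * R => z.1 0 i).
  exact: smooth_on_coord_comp.
apply: smooth_onB => //; apply: smooth_onM => //.
exact: smooth_on_comp_real.
Qed.

(** Every point of [a1, a2] is a limit of other points of this interval, from
    the right or from the left: this is what makes the limit in [partial_t]
    meaningful, also at the end points. *)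
Lemma within_dnbhs_itv_proper (t : R) :
  a1 <= t <= a2 -> ProperFilter (within `[a1, a2] t^').
Proof.
move=> /andP[t1 t2]; apply: Build_ProperFilter.
move=> nt.
have {}nt : nbhs t [set s | s != t -> s \in `[a1, a2] -> False] by exact: nt.
have [ta|at2] := ltP t a2.
  have nt' : \forall s \near t^'+, s != t -> s \in `[a1, a2] -> False.
    by move: nt; apply: filterS => z nz _; exact: nz.
  near t^'+ => s; have ts : t < s by near: s; exact: nbhs_right_gt.
  have sa : s < a2 by near: s; exact: nbhs_right_lt.
  have sI : s \in `[a1, a2] by rewrite in_itv /= (le_trans t1 (ltW ts)) ltW.
  have ns : s != t -> s \in `[a1, a2] -> False by near: s.
  by apply: ns sI; rewrite gt_eqF.
have a1t : a1 < t by exact: lt_le_trans at2.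
have nt' : \forall s \near t^'-, s != t -> s \in `[a1, a2] -> False.
  by move: nt; apply: filterS => z nz _; exact: nz.
near t^'- => s; have ts : s < t by near: s; exact: nbhs_left_lt.
have a1s : a1 < s by near: s; exact: nbhs_left_gt.
have sI : s \in `[a1, a2] by rewrite in_itv /= (le_trans (ltW ts) t2) andbT ltW.
have ns : s != t -> s \in `[a1, a2] -> False by near: s.
by apply: ns sI; rewrite lt_eqF.
Unshelve. all: by end_near. Qed.

(** The difference quotient is constant because F is affine in t. *)
Lemma partial_t_leaf (x : P) (t : R) :
  a1 <= t <= a2 -> partial_t a1 a2 F x t = - c (x 0 0).
Proof.
move=> /within_dnbhs_itv_proper pF; apply: cvg_lim => //.
apply: (@cvg_trans _ ((fun=> - c (x 0 0)) @ within `[a1, a2] t^')).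
  have quotE : nbhs t [set s | s != t -> s \in `[a1, a2] ->
                        - c (x 0 0) = (F x s - F x t) / (s - t)].
    apply/nbhs_ballP; exists 1 => //= s _ st _; rewrite /F.
    by field; rewrite subr_eq0.
  by apply: near_eq_cvg; exact: quotE.
exact: cvg_cst.
Qed.

Lemma admissible_band : admissible_foliated_representation D a1 a2 S F.
Proof.
split=> //.
- split.
  + exact: open_band.
  + exact: boundary_band.
  + apply/trivIsetP => i j _ _ ij; rewrite -subset0 /S => x /= [->].
    move=> /(mulIf (lt0r_neq0 (c_gt0 _))) e; case/eqP: ij; apply: val_inj.
    move: i j e => [[|[|//]] ?] [[|[|//]] ?] //= e; exfalso;
    by move: a12; rewrite e ltxx.
  + move=> j; split; first exact: smooth_submanifold_graph.
    exact: regular_components_graph.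
- exact: smooth_on_slab_band.
- split; first exact: closure_bandE.
  + move=> t1 t2 _ _ t12; rewrite -subset0 /F => x /= [/subr0_eq -> /subr0_eq].
    by move=> /(mulIf (lt0r_neq0 (c_gt0 _))).
  + exists [set 0]%SET, [set 1]%SET; split.
    * by apply/setP => j; rewrite !inE; case: j => [[|[|//]] ?].
    * by apply/setP => j; rewrite !inE; case: j => [[|[|//]] ?].
    * rewrite leafE; apply/seteqP; split=> x /=.
        by move=> xE; exists 0; rewrite /= ?inE.
      by move=> [j /=]; rewrite inE => /eqP ->.
    * rewrite leafE; apply/seteqP; split=> x /=.
        by move=> xE; exists 1; rewrite /= ?inE.
      by move=> [j /=]; rewrite inE => /eqP ->.
  + by move=> x; split=> _; exact: noncritical_leaf_function.
  + by move=> x t t12; rewrite partial_t_leaf // oppr_eq0 gt_eqF.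
Qed.

End BandBetweenGraphs.

Theorem theorem4 (R : realType) (m : nat) (c : R -> R) (a1 : R)
    (hm : (2 <= m)%N) (hc : smooth_on setT c) (c_gt0 : forall x, 0 < c x)
    (a1_lt0 : a1 < 0) :
  let a2 : R := 1 in
  let F : 'rV[R]_2 -> R -> R := fun x t => x 0 1 - t * c (x 0 0) in
  let S : 'I_2 -> set 'rV[R]_2 := fun i =>
    [set x : 'rV[R]_2 | x 0 1 = (if i == 0 then a1 else a2) * c (x 0 0)] in
  let D : set 'rV[R]_2 :=
    [set x : 'rV[R]_2 | a1 * c (x 0 0) < x 0 1 /\ x 0 1 < a2 * c (x 0 0)] in
  let X : set 'rV[R]_(m.+2) := X_F m a1 a2 F in
  [/\ admissible_foliated_representation D a1 a2 S F,
      smooth_submanifold m X &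
      forall p, ~ critical_point X (fun z => z 0 0) p].
Proof.
case: m hm => [//|[//|m']] _ a2 F S D X.
have a12 : a1 < a2 by exact: lt_trans a1_lt0 ltr01.
split; first exact: admissible_band.
  exact: smooth_submanifold_X_F.
exact: noncritical_X_F.
Qed.
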